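(* Let $L\geq 2$, ${\bf A}\in\mathbb{R}^{M\times N}$ and ${\bf y}\in\mathbb{R}^{M}$. Define the overparameterized loss function $\mathcal{L}_{\text{over}}$ as \begin{equation} \mathcal{L}_{\text{over}}\big({\bf x}^{(1)}, \dots, {\bf x}^{(L)}\big) := \frac{1}{2}\,\|{\bf A}\tilde{\bf x}-{\bf y}\|_2^2 \end{equation} where $\tilde{\bf x} = {\bf x}^{(1)}\odot \cdots\odot {\bf x}^{(L)}$. Let ${\bf x}_0 > \boldsymbol{0}$ be fixed and, for any $k$, let ${\bf x}^{(k)}(t)$ follow the flow $\big({\bf x}^{(k)}\big)'(t) = -\nabla_{{\bf x}^{(k)}} \mathcal{L}_{\text{over}}$ with ${\bf x}^{(k)}(0) = {\bf x}_0$. Let $S_+ := \operatorname{argmin}_{{\bf z} \ge \boldsymbol{0}} \| {\bf A}{\bf z} - {\bf y} \|_2^2$ be the set of solutions of the non-negative least squares problem. Then the limit $\tilde{\bf x}_\infty:= \lim_{t\to\infty} \tilde{\bf x}(t)$ exists and lies in $S_+$. Moreover, for ${\bf y}_+ := {\bf A}{\bf x}_+$ with ${\bf x}_+ \in S_+$, there exists an absolute constant $C > 0$ that only depends on the choice of ${\bf A}$, ${\bf y}$, and ${\bf x}_0$ such that \begin{align*} \| {\bf A} \tilde{\bf x}(t) - {\bf y}_+ \|_2^2 \le \frac{C}{t}, \end{align*} for any $t > 0$.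
   Context: $\odot$ denotes the Hadamard (entry-wise) product. ${\bf y}_+ = {\bf A}{\bf x}_+$ does not depend on the choice of ${\bf x}_+ \in S_+$: it is the unique Euclidean projection of ${\bf y}$ onto the closed convex set $C_+ := \{ {\bf A}{\bf z} \colon {\bf z} \ge \boldsymbol{0} \}$. Inequalities between vectors are entry-wise.
   Formalization: The constant C may depend on L as well as on A, y and x_0; independence of L is false (for A = y = 1 and x_0 = 1/2 the smallest possible C grows exponentially with L). *)

(* Defs.v *)
From HB Require Import structures.
From mathcomp Require Import all_boot all_order all_algebra.
From mathcomp Require Import all_classical all_reals all_analysis.
Set Implicit Arguments. Unset Strict Implicit. Unset Printing Implicit Defensive.
Import Order.TTheory GRing.Theory Num.Theory.
Import numFieldNormedType.Exports.
Local Open Scope ring_scope.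

Definition sqnorm (R : realType) (n : nat) (v : 'cV[R]_n) : R :=
  \sum_(i < n) (v i 0) ^+ 2.

Definition hadL (R : realType) (L N : nat) (X : 'I_L -> 'cV[R]_N) : 'cV[R]_N :=
  \col_(i < N) \prod_(k < L) X k i 0.

Definition Lover (R : realType) (M N L : nat) (A : 'M[R]_(M, N)) (y : 'cV[R]_M)
  (X : 'I_L -> 'cV[R]_N) : R :=
  2^-1 * sqnorm (A *m hadL X - y).

Definition perturb (R : realType) (L N : nat) (X : 'I_L -> 'cV[R]_N)
  (k : 'I_L) (i : 'I_N) (s : R) : 'I_L -> 'cV[R]_N :=
  fun l => if l == k then X l + s *: delta_mx i 0 else X l.

Definition grad_Lover (R : realType) (M N L : nat) (A : 'M[R]_(M, N))
  (y : 'cV[R]_M) (X : 'I_L -> 'cV[R]_N) (k : 'I_L) (i : 'I_N) : R :=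
  derive1 (fun s : R => Lover A y (perturb X k i s)) 0.

Definition NNLS_sol (R : realType) (M N : nat) (A : 'M[R]_(M, N))
  (y : 'cV[R]_M) (z : 'cV[R]_N) : Prop :=
  (forall i, 0 <= z i 0) /\
  forall w : 'cV[R]_N, (forall i, 0 <= w i 0) ->
    sqnorm (A *m z - y) <= sqnorm (A *m w - y).

(* Main.v *)
(* The difference of two factors solves a homogeneous linear equation with initial
   value 0, so all factors equal a common positive [u], with [u' = - g u^(L-1)]
   and [g = A^T (A u^L - y)]. For [b >= 0] the function
   [E_b(u) = sum_i (u_i^2 - b_i^2) / 2 + b_i^L (phi u_i - phi b_i)], where
   [phi' u = - u^(1-L)], dominates [|u - b|^2 / 2], and along the flow
   [E_b' = - <u^L - b^L, g>]. If [b^L] is a minimizer of the non-negative least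
   squares problem, this is at most [- (F(u) - F_min)], with [F] the (decreasing)
   loss; so [t (F(u) - F_min) + E_b(u)] decreases, which gives the rate, and [u]
   is bounded. A cluster point [c] of [u] then yields a minimizer [c^L], and
   [E_c(u)], being monotone and small near [c], tends to 0. *)
Require Import Defs.
From HB Require Import structures.
From mathcomp Require Import all_boot all_order all_algebra.
From mathcomp Require Import all_classical all_reals all_analysis.
From mathcomp Require Import ring lra.
Import Order.TTheory GRing.Theory Num.Theory.
Import numFieldNormedType.Exports.
Local Open Scope ring_scope.
Local Open Scope classical_set_scope.

(** * Inner product and squared norm of column vectors *)

Definition dot {R : realType} {n : nat} (u v : 'cV[R]_n) : R :=
  \sum_(i < n) u i 0 * v i 0.

Lemma dot_mulmx {R : realType} {m n : nat} (A : 'M[R]_(m, n)) u v :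
  dot (A *m u) v = dot u (A^T *m v).
Proof.
rewrite /dot; under eq_bigr do rewrite mxE mulr_suml.
rewrite exchange_big /=; apply: eq_bigr => i _.
rewrite mxE mulr_sumr; apply: eq_bigr => j _.
by rewrite mxE mulrCA mulrA.
Qed.

Lemma dotZl {R : realType} {n : nat} a (u v : 'cV[R]_n) :
  dot (a *: u) v = a * dot u v.
Proof. by rewrite /dot mulr_sumr; apply: eq_bigr => i _; rewrite mxE mulrA. Qed.

Lemma dotDl {R : realType} {n : nat} (u v w : 'cV[R]_n) :
  dot (u + v) w = dot u w + dot v w.
Proof.
by rewrite /dot -big_split; apply: eq_bigr => i _; rewrite mxE mulrDl.
Qed.

Lemma dotC {R : realType} {n : nat} (u v : 'cV[R]_n) : dot u v = dot v u.
Proof. by apply: eq_bigr => i _; rewrite mulrC. Qed.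

Lemma sqnormD {R : realType} {n : nat} (u v : 'cV[R]_n) :
  sqnorm (u + v) = sqnorm u + 2 * dot u v + sqnorm v.
Proof.
rewrite /sqnorm /dot mulr_sumr -!big_split; apply: eq_bigr => i _ /=.
by rewrite mxE; ring.
Qed.

Lemma sqnormZ {R : realType} {n : nat} a (u : 'cV[R]_n) :
  sqnorm (a *: u) = a ^+ 2 * sqnorm u.
Proof. by rewrite /sqnorm mulr_sumr; apply: eq_bigr => i _; rewrite mxE exprMn. Qed.

Lemma sqnorm_ge0 {R : realType} {n : nat} (u : 'cV[R]_n) : 0 <= sqnorm u.
Proof. by apply: sumr_ge0 => i _; rewrite sqr_ge0. Qed.

(** * Existence and first-order optimality of non-negative least squares solutions *)

Lemma mul_trmx_eq0 {R : realType} {m n : nat} (B : 'M[R]_(m, n)) :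
  B^T *m B = 0 -> B = 0.
Proof.
move=> /matrixP BB; apply/matrixP => i j; rewrite mxE.
have := BB j j; rewrite !mxE => /eqP.
under eq_bigr do rewrite mxE.
rewrite psumr_eq0 => [/allP/(_ i)|k _]; last exact: sqr_ge0.
by rewrite mem_index_enum mulf_eq0 orbb => /(_ isT)/eqP.
Qed.

(** [A] and [A^T A] have the same row space: if [K] is the cokernel of [A^T A], then
    [(A K)^T (A K) = 0], so [A K = 0]. Hence [y^T A] is a combination [D] of the rows of [A^T A]. *)
Lemma normal_equation {R : realType} {m n : nat} (A : 'M[R]_(m, n))
    (y : 'cV[R]_m) :
  exists w : 'cV[R]_n, A^T *m (A *m w - y) = 0.
Proof.
have /submxP[D Dy] : (y^T *m A <= A^T *m A)%MS.
  apply: (submx_trans (submxMl _ _)); rewrite submxE; apply/eqP/mul_trmx_eq0.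
  by rewrite trmx_mul -mulmxA (mulmxA A^T) mulmx_coker mulmx0.
exists D^T; rewrite mulmxBr; apply/eqP; rewrite subr_eq0; apply/eqP.
by apply: trmx_inj; rewrite !trmx_mul !trmxK Dy -mulmxA.
Qed.

Definition supported {R : realType} {n : nat} (S : {set 'I_n}) (z : 'cV[R]_n) :=
  forall i, i \notin S -> z i 0 = 0.

(** This is the normal equation of [A *m D], with [D] the diagonal projection onto the coordinates
    in [S]; the vectors supported in [S] are those fixed by [D]. *)
Lemma supported_normal_equation {R : realType} {m n : nat} (A : 'M[R]_(m, n)) (y : 'cV[R]_m)
    (S : {set 'I_n}) :
  exists2 w : 'cV[R]_n, supported S w &
    forall v, supported S v -> dot (A *m v) (A *m w - y) = 0.
Proof.
pose D : 'M[R]_n := diag_mx (\row_j (j \in S)%:R).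
have DE (v : 'cV[R]_n) i : (D *m v) i 0 = (i \in S)%:R * v i 0.
  by rewrite mul_diag_mx !mxE.
have [w Hw] := normal_equation (A *m D) y.
exists (D *m w) => [i iS|v vS]; first by rewrite DE (negbTE iS) mul0r.
have -> : v = D *m v.
  apply/colP => i; rewrite DE; case: (boolP (i \in S)) => [|/vS ->].
    by rewrite mul1r.
  by rewrite mulr0.
rewrite !mulmxA dot_mulmx Hw.
by rewrite /dot big1 // => i _; rewrite mxE mulr0.
Qed.

(** Ratio test: among the coordinates negative at [w], the one with the least [z_i / (z_i - w_i)] is
    the first to vanish on the segment from [z] to [w]. *)
Lemma orthant_exit {R : realType} {n : nat} (z w : 'cV[R]_n) :
  (forall i, 0 <= z i 0) -> ~ (forall i, 0 <= w i 0) ->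
  exists s i, [/\ 0 <= s <= 1, w i 0 < 0, (z + s *: (w - z)) i 0 = 0 &
    forall j, 0 <= (z + s *: (w - z)) j 0].
Proof.
move=> z0 /existsNP[i0 /negP]; rewrite -ltNge => wi0.
case: (@arg_minP _ _ _ i0 (fun i => w i 0 < 0) (fun i => z i 0 / (z i 0 - w i 0)) wi0)
  => i wi imin.
have d0 j : w j 0 < 0 -> 0 < z j 0 - w j 0.
  by move=> wj; rewrite subr_gt0; apply: lt_le_trans (z0 j).
have s0 : 0 <= z i 0 / (z i 0 - w i 0).
  by rewrite divr_ge0 // ltW // d0.
have s1 : z i 0 / (z i 0 - w i 0) <= 1.
  by rewrite ler_pdivrMr ?d0 // mul1r lerBrDr gerDl ltW.
exists (z i 0 / (z i 0 - w i 0)), i; split => //; first by rewrite s0 s1.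
  by rewrite !mxE; field; rewrite gt_eqF // d0.
move=> j; rewrite !mxE; have [wj|wj] := ltP (w j 0) 0.
  have := imin j wj; rewrite ler_pdivlMr ?d0 // => h.
  by rewrite -[w j 0 - z j 0]opprB mulrN subr_ge0.
set s := (X in X * _).
have -> : z j 0 + s * (w j 0 - z j 0) = (1 - s) * z j 0 + s * w j 0 by ring.
by rewrite addr_ge0 // mulr_ge0 // subr_ge0.
Qed.

(* If the least-squares minimizer [w] on the span of a face is not itself in the
   face, then moving any [z] of the face towards [w] does not increase the
   objective, and it leaves the face through a smaller one. *)
Lemma nnls_face_exists {R : realType} {m n : nat} (A : 'M[R]_(m, n)) (y : 'cV[R]_m)
    (S : {set 'I_n}) :
  exists z : 'cV[R]_n, [/\ forall i, 0 <= z i 0, supported S z &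
    forall v : 'cV[R]_n, (forall i, 0 <= v i 0) -> supported S v ->
      sqnorm (A *m z - y) <= sqnorm (A *m v - y)].
Proof.
move: {2}#|S| (erefl #|S|) => k; elim: k S => [|k IH] S Sk.
  exists 0; split=> [i|i _|v _ vS]; rewrite ?mxE //.
  suff -> : v = 0 by [].
  apply/colP => i; rewrite mxE; apply: vS.
  by move/eqP: Sk; rewrite cards_eq0 => /eqP ->; rewrite inE.
have [w wS wN] := supported_normal_equation A y S.
(* Pythagoras: the residual at [w] is orthogonal to the image of the vectors supported in [S]. *)
have FE v : supported S v ->
    sqnorm (A *m v - y) = sqnorm (A *m w - y) + sqnorm (A *m (v - w)).
  move=> vS; have -> : A *m v - y = (A *m w - y) + A *m (v - w).
    by rewrite mulmxBr; apply/colP => i; rewrite !mxE; ring.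
  rewrite sqnormD dotC wN ?mulr0 ?addr0 // => i iS.
  by rewrite !mxE vS // wS // subr0.
have [w0|w0] := pselect (forall i, 0 <= w i 0).
  by exists w; split => // v _ vS; rewrite (FE v) // lerDl sqnorm_ge0.
have /fin_all_exists[f fP] : forall j : 'I_n, exists z : 'cV[R]_n, j \in S ->
    [/\ forall i, 0 <= z i 0, supported (S :\ j) z &
      forall v : 'cV[R]_n, (forall i, 0 <= v i 0) -> supported (S :\ j) v ->
        sqnorm (A *m z - y) <= sqnorm (A *m v - y)].
  move=> j; have [jS|jS] := boolP (j \in S); last by exists 0.
  have [|z zP] := IH (S :\ j); last by exists z.
  by move: Sk; rewrite (cardsD1 j) jS add1n => -[].
have [j0 j0S] : exists j, j \in S by apply/card_gt0P; rewrite Sk.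
(* The candidate is the best of the minimizers [f j] over the facets [S :\ j]. *)
case: (@arg_minP _ _ _ j0 (fun j => j \in S) (fun j => sqnorm (A *m f j - y)) j0S)
  => j jS jmin.
have [fj0 fjS _] := fP j jS.
exists (f j); split => // [i iS|v v0 vS]; first by apply: fjS; rewrite !inE negb_and iS orbT.
have [s [i [/andP[s0 s1] wi zi z0]]] := orthant_exit v w v0 w0.
have iS : i \in S by apply: contraTT wi => /wS ->; rewrite ltxx.
set z := v + s *: (w - v) in zi z0.
have zS : supported S z.
  by move=> l lS; rewrite !mxE (vS l) // (wS l) // subrr mulr0 addr0.
have [_ _ /(_ z z0) fimin] := fP i iS.
apply: (le_trans (jmin i iS)); apply: (le_trans (fimin _)).
  move=> l; rewrite !inE negb_and negbK => /orP[/eqP -> //|]; exact: zS.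
rewrite (FE z) // (FE v) // lerD2l.
have -> : z - w = (1 - s) *: (v - w).
  by apply/colP => l; rewrite !mxE; ring.
rewrite -scalemxAr sqnormZ ler_piMl ?sqnorm_ge0 // expr_le1 ?subr_ge0 //.
by rewrite gerBl.
Qed.

Lemma nnls_exists {R : realType} {m n : nat} (A : 'M[R]_(m, n))
    (y : 'cV[R]_m) :
  exists z : 'cV[R]_n, NNLS_sol A y z.
Proof.
have [z [z0 _ zmin]] := nnls_face_exists A y [set: 'I_n]%SET.
by exists z; split => // v v0; apply: zmin => // i; rewrite inE.
Qed.

Lemma nnls_variational {R : realType} {m n : nat} (A : 'M[R]_(m, n)) (y : 'cV[R]_m)
    (z w : 'cV[R]_n) :
  NNLS_sol A y z -> (forall i, 0 <= w i 0) ->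
  0 <= dot (A *m (w - z)) (A *m z - y).
Proof.
move=> [z0 zmin] w0; set d := A *m (w - z); set r := A *m z - y.
have key s : 0 <= s <= 1 -> 0 <= 2 * s * dot d r + s ^+ 2 * sqnorm d.
  move=> /andP[s0 s1]; have := zmin (z + s *: (w - z)).
  have -> : A *m (z + s *: (w - z)) - y = r + s *: d.
    by rewrite mulmxDr -scalemxAr addrAC.
  rewrite -/r (sqnormD r) sqnormZ dotC dotZl -addrA lerDl mulrA; apply => i.
  have -> : (z + s *: (w - z)) i 0 = (1 - s) * z i 0 + s * w i 0.
    by rewrite !mxE; ring.
  by rewrite addr_ge0 // mulr_ge0 // subr_ge0.
rewrite leNgt; apply/negP => dr0.
have q0 : 0 < sqnorm d - dot d r by rewrite subr_gt0 (lt_le_trans dr0) ?sqnorm_ge0.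
(* With [p = - dot d r > 0], this is [p / (|d|^2 + p)]: it lies in []0, 1]] and satisfies
   [s |d|^2 <= p], so [2 (dot d r) + s |d|^2 <= - p < 0], against [key]. *)
pose s := - dot d r / (sqnorm d - dot d r).
have s0 : 0 < s by rewrite divr_gt0 // oppr_gt0.
have s1 : s <= 1 by rewrite ler_pdivrMr // mul1r lerDr sqnorm_ge0.
have := key s; rewrite s1 ltW // => /(_ isT).
have -> : 2 * s * dot d r + s ^+ 2 * sqnorm d = s * (2 * dot d r + s * sqnorm d).
  by ring.
rewrite pmulr_rge0 //; apply/negP; rewrite -ltNge.
have : s * sqnorm d <= - dot d r.
  rewrite /s mulrAC ler_pdivrMr //; apply: ler_wpM2l.
    by rewrite oppr_ge0 ltW.
  by rewrite lerDl oppr_ge0 ltW.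
lra.
Qed.

(** * Rules for derivatives and continuity, and monotonicity *)

Lemma is_derive_mul {R : realType} (f g : R -> R) (t a b : R) :
  is_derive t 1 f a -> is_derive t 1 g b ->
  is_derive t 1 (fun s => f s * g s) (f t * b + g t * a).
Proof. exact: is_deriveM. Qed.

Lemma is_derive_add {R : realType} (f g : R -> R) (t a b : R) :
  is_derive t 1 f a -> is_derive t 1 g b ->
  is_derive t 1 (fun s => f s + g s) (a + b).
Proof. exact: is_deriveD. Qed.

Lemma is_derive_scale {R : realType} (c : R) (f : R -> R) (t a : R) :
  is_derive t 1 f a -> is_derive t 1 (fun s => c * f s) (c * a).
Proof. exact: is_deriveZ. Qed.

Lemma is_derive_pow {R : realType} (f : R -> R) n (t a : R) :
  is_derive t 1 f a -> is_derive t 1 (fun s => f s ^+ n.+1) (n.+1%:R * f t ^+ n * a).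
Proof.
move=> fa; have /= := is_deriveX n.+1 fa.
suff -> : f ^+ n.+1 = (fun s => f s ^+ n.+1) by [].
by apply/funext => s; elim: n {fa} => // n IH; rewrite exprS [RHS]exprS -IH.
Qed.

Lemma is_derive_bigsum {R : realType} N (f : 'I_N -> R -> R) (t : R) (a : 'I_N -> R) :
  (forall i, is_derive t 1 (f i) (a i)) ->
  is_derive t 1 (fun s => \sum_i f i s) (\sum_i a i).
Proof.
move=> fa; have := is_derive_sum fa.
by congr is_derive; apply/funext => s; rewrite fct_sumE.
Qed.

Lemma continuous_bigsum {T : topologicalType} {R : realType} N (f : 'I_N -> T -> R) :
  (forall i, continuous (f i)) -> continuous (fun x => \sum_i f i x).
Proof.
move=> fc x; exact: (@cvg_big R _ _ 0 xpredT (@add_continuous R) T (nbhs x)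
  (index_enum 'I_N) f (fun i => f i x) _ (fun i _ => fc i x)).
Qed.

Lemma continuous_bigprod {T : topologicalType} {R : realType} N (P : pred 'I_N)
    (f : 'I_N -> T -> R) :
  (forall i, continuous (f i)) -> continuous (fun x => \prod_(i | P i) f i x).
Proof.
move=> fc x; exact: (@cvg_big R _ _ 1 P (@mul_continuous R) T (nbhs x)
  (index_enum 'I_N) f (fun i => f i x) _ (fun i _ => fc i x)).
Qed.

Lemma continuous_pow {T : topologicalType} {R : realType} n (f : T -> R) x :
  {for x, continuous f} -> {for x, continuous (fun s => f s ^+ n)}.
Proof.
by move=> fc; apply: (@continuous_comp _ _ _ f (fun y => y ^+ n));
  [exact: fc|exact: exprn_continuous].
Qed.

(** The derivative is asked for only after [s], because the flow equation holds only at positive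
    times; continuity takes care of the endpoint. *)
Lemma nonincreasing_of_derive_le0 {R : realType} (f df : R -> R) (s t : R) :
  continuous f -> (forall r, s < r -> is_derive r 1 f (df r)) ->
  (forall r, s < r < t -> df r <= 0) -> s <= t -> f t <= f s.
Proof.
move=> fc fd df0; rewrite le_eqVlt => /predU1P[->//|st].
have fd' r : r \in `]s, t[%R -> is_derive r 1 f (df r).
  by rewrite in_itv /= => /andP[sr _]; exact: fd.
have [r rst E] := MVT st fd' (continuous_subspaceT fc).
by rewrite in_itv /= in rst; rewrite -subr_le0 E mulr_le0_ge0 ?df0 // subr_ge0 ltW.
Qed.

(** * Homogeneous linear differential equations *)

Lemma is_derive_weighted_sq {R : realType} (u a : R -> R) (c t : R) :
  is_derive t 1 u (a t * u t) ->
  is_derive t 1 (fun s => expR (c * s) * u s ^+ 2)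
    ((c + 2 * a t) * (expR (c * t) * u t ^+ 2)).
Proof.
move=> ud; have h : is_derive t 1 (fun s : R => c * s) (c * 1).
  exact: is_derive_scale.
have := is_derive_mul _ _ _ _ _ (is_derive1_comp (is_derive_expR (c * t)) h)
  (is_derive_pow u 1 t _ ud).
by move=> d; apply: (is_derive_eq d) => /=; ring.
Qed.

Lemma continuous_weighted_sq {R : realType} (u : R -> R) (c : R) :
  continuous u -> continuous (fun s => expR (c * s) * u s ^+ 2).
Proof.
move=> uc s; apply: cvgM; last exact/continuous_pow/uc.
apply: (@continuous_comp _ _ _ (fun s : R => c * s) expR); last exact: continuous_expR.
exact: mulrl_continuous.
Qed.

Lemma continuous_segment_bounded {R : realType} (a : R -> R) (T : R) :
  continuous a -> 0 <= T -> exists B, forall s, 0 <= s <= T -> `|a s| <= B.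
Proof.
move=> ac T0; have nc : continuous (fun s => `|a s|).
  by move=> s; apply: cvg_norm; exact: ac.
have [c _ cmax] := EVT_max T0 (continuous_subspaceT nc).
by exists `|a c| => s sT; apply: cmax; rewrite in_itv.
Qed.

(* With [B] bounding [|a|] up to time [T], [exp (- 2 B t) u^2] is nonincreasing
   and [exp (2 B t) u^2] is nondecreasing. *)
Lemma linear_ode_sq_bounds {R : realType} (u a : R -> R) (T : R) :
  continuous u -> continuous a ->
  (forall t : R, 0 < t -> is_derive t 1 u (a t * u t)) -> 0 <= T ->
  exists c, expR (- c * T) * u T ^+ 2 <= u 0 ^+ 2 /\
            u 0 ^+ 2 <= expR (c * T) * u T ^+ 2.
Proof.
move=> uc ac ud T0; have [B aB] := continuous_segment_bounded a T ac T0.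
have w0 (c t : R) : 0 <= expR (c * t) * u t ^+ 2.
  by rewrite mulr_ge0 ?expR_ge0 ?sqr_ge0.
have e0 (c : R) : u 0 ^+ 2 = expR (c * 0) * u 0 ^+ 2 by rewrite mulr0 expR0 mul1r.
have aBr (r : R) : 0 < r < T -> - B <= a r <= B.
  by move=> /andP[r0 rT]; rewrite -ler_norml aB // !ltW.
exists (2 * B); split.
  rewrite [leRHS](e0 (- (2 * B))).
  apply: (nonincreasing_of_derive_le0 (fun s => expR (- (2 * B) * s) * u s ^+ 2)
    (fun r => (- (2 * B) + 2 * a r) * (expR (- (2 * B) * r) * u r ^+ 2))) => //.
  - exact: continuous_weighted_sq.
  - by move=> r r0; apply: is_derive_weighted_sq; exact: ud.
  - by move=> r /aBr /andP[_ ?]; rewrite mulr_le0_ge0 //; lra.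
suff : -1 * (expR (2 * B * T) * u T ^+ 2) <= -1 * (expR (2 * B * 0) * u 0 ^+ 2).
  by rewrite !mulN1r lerN2 mulr0 expR0 mul1r.
apply: (nonincreasing_of_derive_le0 (fun s => -1 * (expR (2 * B * s) * u s ^+ 2))
  (fun r => -1 * ((2 * B + 2 * a r) * (expR (2 * B * r) * u r ^+ 2)))) => //.
- move=> s; apply: cvgM; [exact: cvg_cst|exact: continuous_weighted_sq].
- by move=> r r0; apply: is_derive_scale; apply: is_derive_weighted_sq; exact: ud.
- move=> r /aBr /andP[? _]; rewrite mulN1r oppr_le0 mulr_ge0 //; lra.
Qed.

Lemma linear_ode_zero {R : realType} (u a : R -> R) (t : R) :
  continuous u -> continuous a ->
  (forall t : R, 0 < t -> is_derive t 1 u (a t * u t)) -> 0 <= t ->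
  u 0 = 0 -> u t = 0.
Proof.
move=> uc ac ud t0 u0; have [c [h _]] := linear_ode_sq_bounds u a t uc ac ud t0.
apply/eqP; rewrite -sqrf_eq0 eq_le sqr_ge0 andbT.
by move: h; rewrite u0 expr0n /= pmulr_rle0 ?expR_gt0.
Qed.

(** Otherwise the intermediate value theorem gives a zero [c] of [u], and the bound of [u 0 ^+ 2] by
    a multiple of [u c ^+ 2] forces [u 0 = 0]. *)
Lemma linear_ode_pos {R : realType} (u a : R -> R) (t : R) :
  continuous u -> continuous a ->
  (forall t : R, 0 < t -> is_derive t 1 u (a t * u t)) -> 0 <= t ->
  0 < u 0 -> 0 < u t.
Proof.
move=> uc ac ud t0 u0; rewrite ltNge; apply/negP => ut.
have [|c] := @IVT _ u 0 t 0 t0 (continuous_subspaceT uc).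
  by rewrite ge_min ut orbT le_max ltW.
rewrite in_itv /= => /andP[c0 ct] uc0.
have [d [_ h]] := linear_ode_sq_bounds u a c uc ac ud c0.
by move: h; rewrite uc0 expr0n mulr0 leNgt exprn_gt0.
Qed.

(** * The potential [phi] and its convexity *)

(** An antiderivative of [- u^(1-L)] on the positive reals, where [L = n + 2]; the logarithm is the
    case [L = 2]. *)
Definition phi {R : realType} (n : nat) (u : R) : R :=
  if n is 0 then - ln u else n%:R^-1 * u^-1 ^+ n.

Lemma is_derive_phi {R : realType} n (u : R) :
  0 < u -> is_derive u 1 (phi n) (- u^-1 ^+ n.+1).
Proof.
move=> u0; case: n => [|n].
  by rewrite expr1; apply: is_deriveN; exact: is_derive1_ln.
have uV : is_derive u 1 (fun y : R => y^-1) (- u ^- 2 *: 1).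
  by apply: (@is_deriveV _ id); rewrite ?gt_eqF.
apply: (is_derive_eq (is_derive_scale _ _ _ _ (is_derive_pow _ n _ _ uV))).
rewrite mulrA mulrA mulVf ?pnatr_eq0 // mul1r /GRing.scale /= mulr1.
by rewrite mulrN -exprVn -exprD addnC.
Qed.

Lemma ln_le_subr1 {R : realType} (r : R) : 0 < r -> ln r <= r - 1.
Proof.
by move=> r0; rewrite lerBrDl -{2}(lnK r0); exact: expR_ge1Dx.
Qed.

(** Convexity of [phi], reduced by [r = u / b] to [ln r <= r - 1]; for a power, [r^(-m) = exp (- m
    ln r) >= 1 - m ln r >= 1 - m (r - 1)]. *)
Lemma phi_tangent {R : realType} n (b u : R) : 0 < b -> 0 < u ->
  - (b^-1 ^+ n.+1) * (u - b) <= phi n u - phi n b.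
Proof.
move=> b0 u0; have r0 : 0 < u / b by rewrite divr_gt0.
have lnr : ln (u / b) <= u / b - 1 by exact: ln_le_subr1.
have E : b^-1 * (u - b) = u / b - 1.
  by rewrite mulrBr mulVf ?gt_eqF // mulrC.
rewrite exprSr mulNr -mulrA E; case: n => [|n] /=.
  by move: lnr; rewrite ln_div ?posrE // expr0 mul1r; lra.
have -> : u^-1 = b^-1 * (u / b)^-1 by rewrite invf_div mulrA mulVf ?mul1r ?gt_eqF.
rewrite exprMn; set r := u / b in r0 lnr *.
have -> : r^-1 ^+ n.+1 = expR (n.+1%:R * - ln r).
  by rewrite expRM_natl expRN lnK.
rewrite -mulrN -mulrBr -{3}[b^-1 ^+ n.+1]mulr1 -mulrBr mulrCA.
rewrite ler_pM2l ?exprn_gt0 ?invr_gt0 // ler_pdivlMl ?ltr0Sn //.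
rewrite lerBrDl; apply: le_trans (expR_ge1Dx _); rewrite lerD2l.
by rewrite ler_pM2l ?ltr0Sn // lerN2.
Qed.

(** * The least squares loss and the gradient of the overparameterized loss *)

Lemma is_derive_lsq {R : realType} {m n : nat} (A : 'M[R]_(m, n)) (y : 'cV[R]_m)
    (z : R -> 'cV[R]_n) (dz : 'cV[R]_n) (t : R) :
  (forall i, is_derive t 1 (fun s => z s i 0) (dz i 0)) ->
  is_derive t 1 (fun s => 2^-1 * sqnorm (A *m z s - y))
    (dot dz (A^T *m (A *m z t - y))).
Proof.
move=> zd; pose r j s := \sum_i A j i * z s i 0 + (- y j 0).
have rE s j : (A *m z s - y) j 0 = r j s by rewrite !mxE.
have -> : (fun s => 2^-1 * sqnorm (A *m z s - y)) =
    (fun s => 2^-1 * \sum_j r j s ^+ 2).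
  by apply/funext => s; congr (_ * _); apply: eq_bigr => j _; rewrite rE.
have rd j : is_derive t 1 (r j) (\sum_i A j i * dz i 0 + 0).
  apply: is_derive_add; apply: is_derive_bigsum => i; exact: is_derive_scale.
have := is_derive_scale 2^-1 _ _ _
  (is_derive_bigsum _ _ _ _ (fun j => is_derive_pow _ 1 _ _ (rd j))).
move=> d; apply: (is_derive_eq d); rewrite -dot_mulmx /dot mulr_sumr.
apply: eq_bigr => j _; rewrite expr1 addr0 rE mxE.
by field.
Qed.

Lemma continuous_mulmx {T : topologicalType} {R : realType} {m n : nat}
    (A : 'M[R]_(m, n)) (z : T -> 'cV[R]_n) j :
  (forall i, continuous (fun s => z s i 0)) ->
  continuous (fun s => (A *m z s) j 0).
Proof.
move=> zc; rewrite (_ : (fun s => _) = (fun s => \sum_i A j i * z s i 0)); last first.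
  by apply/funext => x; rewrite mxE.
by apply: continuous_bigsum => i s; apply: cvgM; [exact: cvg_cst|exact: zc].
Qed.

Lemma continuous_residual {T : topologicalType} {R : realType} {m n : nat}
    (A : 'M[R]_(m, n)) (y : 'cV[R]_m) (z : T -> 'cV[R]_n) j :
  (forall i, continuous (fun s => z s i 0)) ->
  continuous (fun s => (A *m z s - y) j 0).
Proof.
move=> zc; rewrite (_ : (fun s => _) = (fun s => (A *m z s) j 0 + (- y j 0))); last first.
  by apply/funext => x; rewrite !mxE.
by move=> s; apply: cvgD; [exact: continuous_mulmx|exact: cvg_cst].
Qed.

Lemma continuous_lsq {T : topologicalType} {R : realType} {m n : nat}
    (A : 'M[R]_(m, n)) (y : 'cV[R]_m) (z : T -> 'cV[R]_n) :
  (forall i, continuous (fun s => z s i 0)) ->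
  continuous (fun s => 2^-1 * sqnorm (A *m z s - y)).
Proof.
move=> zc s; apply: cvgM; first exact: cvg_cst.
by apply: continuous_bigsum => j {}s; apply: continuous_pow; exact: continuous_residual.
Qed.

(** Perturbing entry [i] of factor [k] moves only entry [i] of the Hadamard product, affinely, with
    slope the product of the other factors. *)
Lemma grad_LoverE {R : realType} {L M N : nat} (A : 'M[R]_(M, N)) (y : 'cV[R]_M)
    (X : 'I_L -> 'cV[R]_N) k i :
  grad_Lover A y X k i =
  (A^T *m (A *m hadL X - y)) i 0 * \prod_(l | l != k) X l i 0.
Proof.
pose P j := \prod_(l | l != k) X l j 0.
have hE s j : hadL (perturb X k i s) j 0 = (X k j 0 + s * (j == i)%:R) * P j.
  rewrite mxE (bigD1 k) //= /perturb eqxx !mxE eqxx andbT; congr (_ * _).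
  by apply: eq_bigr => l /negbTE ->.
have hX : hadL (perturb X k i 0) = hadL X.
  by apply/colP => j; rewrite hE mul0r addr0 mxE [RHS](bigD1 k).
have hd j : is_derive (0 : R) 1 (fun s => hadL (perturb X k i s) j 0)
    ((\col_j ((j == i)%:R * P j)) j 0).
  under [X in is_derive _ _ X]eq_fun do rewrite hE.
  have d1 : is_derive (0 : R) 1 (fun s : R => X k j 0 + s * (j == i)%:R)
      (0 + (0 * 0 + (j == i)%:R * 1)).
    by apply: is_derive_add; apply: is_derive_mul.
  have d2 := is_derive_mul _ _ _ _ _ d1 (is_derive_cst (P j) (0 : R) 1).
  by apply: (is_derive_eq d2); rewrite mxE /=; ring.
rewrite /grad_Lover /Lover derive1E (derive_val (is_derive := is_derive_lsq A y _ _ _ hd)).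
rewrite hX /dot (bigD1 i) //= big1 => [|j /negbTE ji]; last first.
  by rewrite !mxE ji !mul0r.
by rewrite [X in X * _]mxE eqxx mul1r addr0 mulrC.
Qed.

(** * The divergence [breg] *)

(** For [L = n + 2], this is the Bregman divergence between [b^L] and [u^L] of a potential with
    second derivative [x^(2/L - 2) / L]. At [b = 0] the factor [b ^+ n.+2] vanishes and removes the
    default value of [phi n 0]. *)
Definition breg {R : realType} (n : nat) (b u : R) : R :=
  2^-1 * (u ^+ 2 - b ^+ 2) + b ^+ n.+2 * (phi n u - phi n b).

(** The tangent inequality times [b^L] gives [b^L (phi u - phi b) >= - b (u - b)], and [(u^2 - b^2)
    / 2 - b (u - b) = (u - b)^2 / 2]. *)
Lemma breg_ge {R : realType} n (b u : R) : 0 <= b -> 0 < u ->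
  2^-1 * (u - b) ^+ 2 <= breg n b u.
Proof.
rewrite le_eqVlt => /predU1P[<-|b0] u0.
  by rewrite /breg expr0n /= subr0 expr0n /= mul0r addr0 subr0.
have := phi_tangent n _ _ b0 u0; rewrite -(ler_pM2l (exprn_gt0 n.+2 b0)).
have -> : b ^+ n.+2 * (- (b^-1 ^+ n.+1) * (u - b)) = - b * (u - b).
  rewrite exprS exprVn; field; by rewrite expf_neq0 // gt_eqF.
by rewrite /breg; move: (b ^+ n.+2 * _) => p; lra.
Qed.

Lemma is_derive_breg {R : realType} n (b u : R) : 0 < u ->
  is_derive u 1 (breg n b) (u - b ^+ n.+2 * u^-1 ^+ n.+1).
Proof.
move=> u0.
have d1 : is_derive u 1 (fun v : R => 2^-1 * (v ^+ 2 + - b ^+ 2))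
    (2^-1 * (2 * u ^+ 1 * 1 + 0)).
  apply: is_derive_scale; apply: is_derive_add; exact: is_derive_pow.
have d2 : is_derive u 1 (fun v : R => b ^+ n.+2 * (phi n v + - phi n b))
    (b ^+ n.+2 * (- u^-1 ^+ n.+1 + 0)).
  apply: is_derive_scale; apply: is_derive_add; exact: is_derive_phi.
apply: (is_derive_eq (is_derive_add _ _ _ _ _ d1 d2)).
by rewrite expr1 !addr0 mulrN mulr1 mulrA mulVf ?mul1r.
Qed.

Lemma is_derive_continuous {R : realType} (f : R -> R) (t a : R) :
  is_derive t 1 f a -> {for t, continuous f}.
Proof.
by move=> fd; apply: differentiable_continuous; apply/derivable1_diffP/ex_derive.
Qed.

(** The case [b = 0] matters because the limit of the flow may have zero entries; there [breg] is
    just [u^2 / 2], although [phi] is singular. *)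
Lemma continuous_breg_diag {R : realType} n (b : R) :
  0 <= b -> {for b, continuous (breg n b)}.
Proof.
rewrite le_eqVlt => /predU1P[<-|b0]; last first.
  exact: (is_derive_continuous _ _ _ (is_derive_breg n b b b0)).
rewrite (_ : breg n 0 = (fun u => 2^-1 * u ^+ 2)); last first.
  by apply/funext => u; rewrite /breg !expr0n /= mul0r addr0 subr0.
by apply: cvgM; [exact: cvg_cst|exact: exprn_continuous].
Qed.

Lemma exists_root {R : realType} n (z : R) : 0 <= z ->
  exists2 b : R, 0 <= b & b ^+ n.+1 = z.
Proof.
move=> z0; exists (z `^ n.+1%:R^-1); first exact: powR_ge0.
by rewrite -powR_mulrn ?powR_ge0 // -powRrM mulVf ?pnatr_eq0 // powRr1.
Qed.

Lemma cvg_mx {T : Type} {F : set_system T} {FF : Filter F} {R : realType} {m n : nat}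
    (f : T -> 'M[R]_(m, n)) (l : 'M[R]_(m, n)) :
  (forall i j, f t i j @[t --> F] --> l i j) -> f t @[t --> F] --> l.
Proof.
move=> fl; apply/cvg_ballP => e e0.
have h i : F [set t | forall j, ball (l i j) e (f t i j)].
  by apply: filter_forall => j; move/cvg_ballP: (fl i j); apply.
have := @filter_forall _ _ (fun i t => forall j, ball (l i j) e (f t i j)) F FF h.
by apply: filterS => t ht; split => // i j; exact: ht.
Qed.

(** * The flow of the common factor and its Lyapunov functions *)

(** The exponent [n.+2] is the number [L] of factors. Trajectories are row vectors, the form to
    which [rV_compact] applies. *)
Definition powv {R : realType} {N : nat} (n : nat) (v : 'rV[R]_N) : 'cV[R]_N :=
  \col_i v 0 i ^+ n.+2.

Definition lsq_obj {R : realType} {M N : nat} (A : 'M[R]_(M, N)) (y : 'cV[R]_M)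
  (n : nat) (v : 'rV[R]_N) : R := 2^-1 * sqnorm (A *m powv n v - y).

Definition lsq_grad {R : realType} {M N : nat} (A : 'M[R]_(M, N)) (y : 'cV[R]_M)
  (n : nat) (v : 'rV[R]_N) : 'cV[R]_N := A^T *m (A *m powv n v - y).

Definition power_flow {R : realType} {M N : nat} (A : 'M[R]_(M, N)) (y : 'cV[R]_M)
    (n : nat) (u : R -> 'rV[R]_N) : Prop :=
  [/\ forall i, continuous (fun t => u t 0 i),
      forall t i, 0 < u t 0 i &
      forall (t : R) i, 0 < t -> is_derive t 1 (fun s => u s 0 i)
        (- lsq_grad A y n (u t) i 0 * u t 0 i ^+ n.+1)].

Definition breg_sum {R : realType} {N : nat} (n : nat) (b v : 'rV[R]_N) : R :=
  \sum_i breg n (b 0 i) (v 0 i).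

Lemma continuous_lsq_obj {R : realType} {M N : nat} (A : 'M[R]_(M, N)) (y : 'cV[R]_M) n :
  continuous (lsq_obj A y n).
Proof.
apply: continuous_lsq => i.
rewrite (_ : (fun _ => _) = (fun v : 'rV[R]_N => v 0 i ^+ n.+2)); last first.
  by apply/funext => v; rewrite mxE.
by move=> v; apply: continuous_pow; exact: coord_continuous.
Qed.

(** With [g] the gradient, the derivative is [- sum_i L (u_i^(L-1) g_i)^2]. *)
Lemma lsq_obj_flow_derive_le0 {R : realType} {M N : nat} (A : 'M[R]_(M, N))
    (y : 'cV[R]_M) (n : nat) (u : R -> 'rV[R]_N) :
  power_flow A y n u ->
  [/\ continuous (fun t => lsq_obj A y n (u t)) &
  exists dF : R -> R, forall t : R, 0 < t ->
    is_derive t 1 (fun s => lsq_obj A y n (u s)) (dF t) /\ dF t <= 0].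
Proof.
move=> [uc u0 ud]; split.
  apply: continuous_lsq => i.
  rewrite (_ : (fun _ => _) = (fun t => u t 0 i ^+ n.+2)); last first.
    by apply/funext => v; rewrite mxE.
  by move=> v; apply: continuous_pow; exact: uc.
pose dz t : 'cV[R]_N :=
  \col_i (n.+2%:R * u t 0 i ^+ n.+1 * (- lsq_grad A y n (u t) i 0 * u t 0 i ^+ n.+1)).
exists (fun t => dot (dz t) (lsq_grad A y n (u t))) => t t0; split.
  apply: is_derive_lsq => i.
  rewrite (_ : (fun _ => _) = (fun t => u t 0 i ^+ n.+2)); last first.
    by apply/funext => v; rewrite mxE.
  by rewrite mxE; apply: is_derive_pow; exact: ud.
apply: sumr_le0 => i _; rewrite [dz t i 0]mxE; set g := lsq_grad A y n (u t) i 0.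
set p := _ ^+ n.+1.
have -> : n.+2%:R * p * (- g * p) * g = - (n.+2%:R * (p * g) ^+ 2) by ring.
by rewrite oppr_le0 mulr_ge0 ?sqr_ge0.
Qed.

(** With [a = A (powv v - z)] and [r = A z - y], the three terms are [|a|^2 / 2],
    [dot a r + |a|^2 / 2] and [dot a r + |a|^2], and [dot a r >= 0] by the variational
    inequality. *)
Lemma lsq_obj_ge {R : realType} {M N : nat} (A : 'M[R]_(M, N)) (y : 'cV[R]_M)
    n (v : 'rV[R]_N) (z : 'cV[R]_N) :
  NNLS_sol A y z -> (forall i, 0 <= v 0 i) ->
  2^-1 * sqnorm (A *m powv n v - A *m z) <=
    lsq_obj A y n v - 2^-1 * sqnorm (A *m z - y) <=
    dot (powv n v - z) (lsq_grad A y n v).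
Proof.
move=> zsol v0; have pv0 i : 0 <= powv n v i 0 by rewrite mxE exprn_ge0.
have := nnls_variational A y z (powv n v) zsol pv0.
rewrite /lsq_grad -dot_mulmx /lsq_obj mulmxBr.
set a := A *m powv n v - A *m z; set r := A *m z - y.
have -> : A *m powv n v - y = r + a by rewrite [RHS]addrC [RHS]addrA subrK.
rewrite -/a; clearbody a r; rewrite (sqnormD r a) (dotC a (r + a)) dotDl (dotC r a).
have -> : dot a a = sqnorm a by [].
have := sqnorm_ge0 a; move: (sqnorm a) (dot a r) (sqnorm r) => p q s p0 q0.
by apply/andP; split; lra.
Qed.

(** The derivative [(u^L - b^L) u^(1-L)] of [breg] meets the factor [u^(L-1)] of the flow, and the
    powers cancel. *)
Lemma breg_sum_flow {R : realType} {M N : nat} (A : 'M[R]_(M, N))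
    (y : 'cV[R]_M) (n : nat) (u : R -> 'rV[R]_N) (b : 'rV[R]_N) :
  power_flow A y n u ->
  continuous (fun t => breg_sum n b (u t)) /\
  forall t : R, 0 < t -> is_derive t 1 (fun s => breg_sum n b (u s))
    (- dot (powv n (u t) - powv n b) (lsq_grad A y n (u t))).
Proof.
move=> [uc u0 ud]; split.
  apply: continuous_bigsum => i t.
  apply: (@continuous_comp _ _ _ (fun t => u t 0 i) (breg n (b 0 i))).
    exact: uc.
  exact: (is_derive_continuous _ _ _ (is_derive_breg n _ _ (u0 t i))).
move=> t t0.
have d i := is_derive1_comp (is_derive_breg n (b 0 i) _ (u0 t i)) (ud t i t0).
apply: (is_derive_eq (is_derive_bigsum _ _ _ _ d)).
rewrite /dot -sumrN; apply: eq_bigr => i _.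
have -> : (powv n (u t) - powv n b) i 0 = u t 0 i ^+ n.+2 - b 0 i ^+ n.+2.
  by rewrite !mxE.
move: (lsq_grad A y n (u t) i 0) => g.
have : u t 0 i ^+ n.+1 != 0 by rewrite expf_neq0 // gt_eqF.
rewrite exprVn (exprS (u t 0 i) n.+1); move: (_ ^+ n.+1) (b 0 i ^+ _) => p q p0.
by field.
Qed.

Lemma breg_sum_ge {R : realType} {N : nat} (n : nat) (b v : 'rV[R]_N) i :
  (forall i, 0 <= b 0 i) -> (forall i, 0 < v 0 i) ->
  2^-1 * (v 0 i - b 0 i) ^+ 2 <= breg_sum n b v.
Proof.
move=> b0 v0; have h j : 0 <= breg n (b 0 j) (v 0 j).
  by apply: le_trans (breg_ge n _ _ (b0 j) (v0 j)); rewrite mulr_ge0 ?sqr_ge0.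
rewrite /breg_sum (bigD1 i) //=; apply: le_trans (breg_ge n _ _ (b0 i) (v0 i)) _.
by rewrite lerDl; apply: sumr_ge0.
Qed.

Lemma breg_sum_ge0 {R : realType} {N : nat} (n : nat) (b v : 'rV[R]_N) :
  (forall i, 0 <= b 0 i) -> (forall i, 0 < v 0 i) -> 0 <= breg_sum n b v.
Proof.
move=> b0 v0; apply: sumr_ge0 => j _.
by apply: le_trans (breg_ge n _ _ (b0 j) (v0 j)); rewrite mulr_ge0 ?sqr_ge0.
Qed.

Lemma breg_sum_flow_nonincreasing {R : realType} {M N : nat} (A : 'M[R]_(M, N))
    (y : 'cV[R]_M) (n : nat) (u : R -> 'rV[R]_N) (b : 'rV[R]_N) (s t : R) :
  power_flow A y n u -> NNLS_sol A y (powv n b) -> 0 <= s -> s <= t ->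
  breg_sum n b (u t) <= breg_sum n b (u s).
Proof.
move=> uf bsol s0 st; have [Ec Ed] := breg_sum_flow A y n u b uf.
have [_ u0 _] := uf.
apply: (nonincreasing_of_derive_le0 (fun r => breg_sum n b (u r))
  (fun r => - dot (powv n (u r) - powv n b) (lsq_grad A y n (u r)))) => //.
  by move=> r sr; apply: Ed; exact: le_lt_trans sr.
move=> r _; rewrite oppr_le0.
have /andP[h1 h2] := lsq_obj_ge A y n _ _ bsol (fun i => ltW (u0 r i)).
apply: le_trans h2; apply: le_trans h1.
by rewrite mulr_ge0 ?sqnorm_ge0.
Qed.

(* The Lyapunov function [t (F(u t) - F_min) + E_b (u t)] is nonincreasing. *)
Lemma power_flow_rate {R : realType} {M N : nat} (A : 'M[R]_(M, N))
    (y : 'cV[R]_M) (n : nat) (u : R -> 'rV[R]_N) (b : 'rV[R]_N) (t : R) :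
  power_flow A y n u -> NNLS_sol A y (powv n b) -> (forall i, 0 <= b 0 i) ->
  0 < t ->
  lsq_obj A y n (u t) - lsq_obj A y n b <= breg_sum n b (u 0) / t.
Proof.
move=> uf bsol b0 t0; have [Ec Ed] := breg_sum_flow A y n u b uf.
have [_ u0 _] := uf.
have [Fc [dF FdF]] := lsq_obj_flow_derive_le0 A y n u uf.
pose G s := dot (powv n (u s) - powv n b) (lsq_grad A y n (u s)).
pose W s := s * (lsq_obj A y n (u s) + - lsq_obj A y n b) + breg_sum n b (u s).
suff : W t <= W 0.
  rewrite /W mul0r add0r => h; rewrite ler_pdivlMr // mulrC.
  by apply: le_trans h; rewrite lerDl; exact: breg_sum_ge0.
apply: (nonincreasing_of_derive_le0 W (fun r =>
  (r * (dF r + 0) + (lsq_obj A y n (u r) + - lsq_obj A y n b) * 1) + - G r)).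
- move=> s; apply: cvgD; last exact: Ec.
  apply: cvgM; first exact: cvg_id.
  by apply: cvgD; [exact: Fc|exact: cvg_cst].
- move=> r r0; apply: is_derive_add; last exact: Ed.
  by apply: is_derive_mul; apply: is_derive_add; case: (FdF r r0).
- move=> r /andP[r0 _]; have [_ dF0] := FdF r r0.
  have /andP[_] := lsq_obj_ge A y n _ _ bsol (fun i => ltW (u0 r i)).
  rewrite -/(lsq_obj A y n b) -/(G r) => h.
  have : r * dF r <= 0 by rewrite mulr_ge0_le0 // ltW.
  by rewrite addr0 mulr1; lra.
- exact: ltW.
Qed.

(** * Boundedness and convergence of the flow *)

Lemma powv_surj {R : realType} {N : nat} (n : nat) (z : 'cV[R]_N) :
  (forall i, 0 <= z i 0) ->
  exists2 b : 'rV[R]_N, forall i, 0 <= b 0 i & powv n b = z.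
Proof.
move=> z0; have /fin_all_exists2[f f0 fz] := fun i => exists_root n.+1 _ (z0 i).
exists (\row_i f i) => [i|]; first by rewrite mxE.
by apply/colP => i; rewrite !mxE fz.
Qed.

Lemma power_flow_bounded {R : realType} {M N : nat} (A : 'M[R]_(M, N))
    (y : 'cV[R]_M) (n : nat) (u : R -> 'rV[R]_N) (b : 'rV[R]_N) (t : R) i :
  power_flow A y n u -> NNLS_sol A y (powv n b) -> (forall i, 0 <= b 0 i) ->
  0 <= t -> u t 0 i <= b 0 i + (1 + breg_sum n b (u 0)).
Proof.
move=> uf bsol b0 t0; have [_ u0 _] := uf.
have := breg_sum_ge n _ _ i b0 (u0 t).
have := breg_sum_flow_nonincreasing A y n u b 0 t uf bsol (lexx 0) t0.
(* This square turns the bound on [(u - b)^2 / 2] into a linear one: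
   [u - b <= ((u - b)^2 + 1) / 2]. *)
have := sqr_ge0 (u t 0 i - b 0 i - 1).
by move: (u t 0 i) (b 0 i) (breg_sum _ _ _) (breg_sum _ _ _) => p q e f; nra.
Qed.

Lemma power_flow_obj_limit {R : realType} {M N : nat} (A : 'M[R]_(M, N))
    (y : 'cV[R]_M) (n : nat) (u : R -> 'rV[R]_N) (b : 'rV[R]_N) (e : R) :
  power_flow A y n u -> NNLS_sol A y (powv n b) -> (forall i, 0 <= b 0 i) ->
  0 < e -> \forall t \near +oo, lsq_obj A y n (u t) <= lsq_obj A y n b + e.
Proof.
move=> uf bsol b0 e0; have [_ u0 _] := uf.
have E0 := breg_sum_ge0 n b (u 0) b0 (u0 0).
exists (breg_sum n b (u 0) / e); split; first exact: num_real.
move=> t et; have t0 : 0 < t by apply: le_lt_trans et; rewrite divr_ge0 // ltW.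
rewrite addrC -lerBlDr.
apply: (le_trans (power_flow_rate A y n u b t uf bsol b0 t0)).
by rewrite ler_pdivrMr // mulrC -ler_pdivrMr // ltW.
Qed.

(* Any cluster point [c] of the bounded trajectory gives a minimizer, so
   [breg_sum n c] is nonincreasing along the flow; it gets arbitrarily small
   near [c], hence tends to 0, and it controls the distance to [c]. *)
Lemma power_flow_cvg {R : realType} {M N : nat} (A : 'M[R]_(M, N))
    (y : 'cV[R]_M) (n : nat) (u : R -> 'rV[R]_N) :
  power_flow A y n u ->
  exists2 c : 'rV[R]_N, NNLS_sol A y (powv n c) &
    forall i, u t 0 i @[t --> +oo] --> c 0 i.
Proof.
move=> uf; have [uc u0 _] := uf.
have [z zsol] := nnls_exists A y.
have [b b0 bz] := powv_surj n z zsol.1; rewrite -{}bz in zsol.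
pose K i : set R := [set` `[0, b 0 i + (1 + breg_sum n b (u 0))]%R].
have Kc i : compact (K i) by exact: segment_compact.
have uK : \forall t \near +oo, forall i, K i (u t 0 i).
  exists 0; split; first exact: num_real.
  move=> t t0 i; rewrite /K /= in_itv /= (ltW (u0 _ _)) /=.
  exact: (power_flow_bounded A y n u b t i uf zsol b0 (ltW t0)).
have [c [cK cclu]] := rV_compact Kc (F := u @ +oo) _ uK.
have c0 i : 0 <= c 0 i by have := cK i; rewrite /K /= in_itv /= => /andP[].
have csol : NNLS_sol A y (powv n c).
  split=> [i|w w0]; first by rewrite mxE exprn_ge0.
  have h : lsq_obj A y n c <= lsq_obj A y n b.
    apply/ler_addgt0Pr => e e0.
    have e20 : 0 < e / 2 by rewrite divr_gt0.
    have h1 := power_flow_obj_limit A y n u b _ uf zsol b0 e20.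
    have h2 : nbhs c [set v | `|lsq_obj A y n c - lsq_obj A y n v| < e / 2].
      by move/cvgrPdist_lt : (continuous_lsq_obj A y n c); apply.
    (* A point of the trajectory that is both late and close to [c]: half of [e] pays for each. *)
    have [v [v1 v2]] := cclu [set v | lsq_obj A y n v <= lsq_obj A y n b + e / 2] _ h1 h2.
    move: v1 v2 => /= v1 /ltr_distlDr v2; lra.
  have := zsol.2 w w0; apply: le_trans.
  by move: h; rewrite /lsq_obj ler_pM2l.
exists c => // i; apply/cvgrPdist_lt => e e0.
have d0 : 0 < 2^-1 * e ^+ 2 by rewrite mulr_gt0 // exprn_gt0.
have h2 : nbhs c [set v | `|breg_sum n c c - breg_sum n c v| < 2^-1 * e ^+ 2].
  suff : {for c, continuous (breg_sum n c)} by move/cvgrPdist_lt; apply.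
  apply: (@cvg_big R _ _ 0 xpredT (@add_continuous R) _ (nbhs c)
    (index_enum 'I_N) (fun j v => breg n (c 0 j) (v 0 j))) => j _.
  apply: (@continuous_comp _ _ _ (fun v : 'rV[R]_N => v 0 j) (breg n (c 0 j))).
    exact: coord_continuous.
  exact: continuous_breg_diag.
(* Clustering is tested on nonnegative times, so that the divergence decreases from the time [s]
   found next. *)
have h1 : (u @ +oo) [set v | exists2 s, 0 <= s & v = u s].
  exists 0; split; first exact: num_real.
  by move=> t t0; exists t => //; exact: ltW.
have [_ [[s s0 ->] /= hs]] := cclu _ _ h1 h2.
exists s; split; first exact: num_real.
move=> t st; have := breg_sum_ge n c (u t) i c0 (u0 t).
have := breg_sum_flow_nonincreasing A y n u c s t uf csol s0 (ltW st).
have cc : breg_sum n c c = 0.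
  by apply: big1 => j _; rewrite /breg !subrr !mulr0 addr0.
rewrite cc sub0r normrN in hs => le1 le2.
have := le_lt_trans (le_trans le2 le1) (le_lt_trans (ler_norm _) hs).
rewrite ltr_pM2l // => he.
rewrite distrC -ltr_sqr ?nnegrE ?normr_ge0 ?(ltW e0) //.
by rewrite real_normK ?num_real.
Qed.

(** * Reduction of the factored flow to the flow of the common factor *)

Lemma continuous_max0 {R : realType} (f : R -> R) :
  f s @[s --> 0^'+] --> f 0 -> (forall t : R, 0 < t -> {for t, continuous f}) ->
  continuous (fun t : R => f (Num.max 0 t)).
Proof.
move=> f0 fc t; case: (ltgtP t 0) => t0.
- apply: (@cvg_trans _ (cst (f 0) @ t)).
    apply: near_eq_cvg; near=> s; rewrite /cst /= max_l // ltW //.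
    by near: s; exact: lt_nbhsl.
  by rewrite max_l ?ltW //; apply: (@cst_continuous R R (f 0) t).
- apply: (@cvg_trans _ (f @ t)).
    apply: near_eq_cvg; near=> s; rewrite max_r // ltW //.
    by near: s; exact: lt_nbhsr.
  by rewrite max_r ?ltW //; exact: fc.
apply/cvgrPdist_lt => e e0 /=; rewrite t0 max_l //.
move/cvgrPdist_lt : f0 => /(_ e e0); rewrite near_withinE => h.
near=> s; have [s0|s0] := ltP 0 s; last by rewrite subrr normr0.
by move: s0; near: s.
Unshelve. all: by end_near. Qed.

Theorem theorem1 (R : realType) (L M N : nat) (A : 'M[R]_(M, N)) (y : 'cV[R]_M)
  (x0 : 'cV[R]_N) (x : R -> 'I_L -> 'cV[R]_N) :
  (2 <= L)%N ->
  (forall i, 0 < x0 i 0) ->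
  (forall k, x 0 k = x0) ->
  (forall k i, (fun s => x s k i 0) @ 0^'+ --> x0 i 0) ->
  (forall k i (t : R), 0 < t ->
     is_derive t 1 (fun s => x s k i 0) (- grad_Lover A y (x t) k i)) ->
  (exists xinf : 'cV[R]_N,
     (fun t => hadL (x t)) @ +oo --> xinf /\ NNLS_sol A y xinf) /\
  (forall xp : 'cV[R]_N, NNLS_sol A y xp ->
     exists C : R, 0 < C /\
       forall t : R, 0 < t -> sqnorm (A *m hadL (x t) - A *m xp) <= C / t).
Proof.
case: L x => [//|[//|n]] x _ x0_gt0 x_init x_right x_deriv.
(* [x] is only constrained for nonnegative times; freezing it before 0 makes it
   continuous on the whole line. *)
pose xe (t : R) := x (Num.max 0 t).
have xeE (t : R) : 0 <= t -> xe t = x t by move=> t0; rewrite /xe max_r.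
have xe_neg (t : R) : t <= 0 -> xe t = xe 0 by move=> t0; rewrite /xe max_l // maxxx.
have xe_cont k i : continuous (fun t => xe t k i 0).
  apply: (continuous_max0 (fun s => x s k i 0)); first by rewrite x_init; exact: x_right.
  by move=> t t0; exact: is_derive_continuous (x_deriv k i t t0).
pose g (t : R) i := (A^T *m (A *m hadL (xe t) - y)) i 0.
have xe_deriv k i (t : R) : 0 < t -> is_derive t 1 (fun s => xe s k i 0)
    (- (g t i * \prod_(l | l != k) xe t l i 0)).
  move=> t0; apply: (near_eq_is_derive (f := fun s => x s k i 0)).
    by near=> s; rewrite xeE // ltW //; near: s; exact: lt_nbhsr.
  by rewrite /g xeE ?ltW // -grad_LoverE; exact: x_deriv.
have g_cont i : continuous (fun t => g t i).
  apply: continuous_mulmx => j; apply: continuous_residual => {}i.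
  rewrite (_ : (fun s => _) = (fun s => \prod_k xe s k i 0)); last first.
    by apply/funext => s; rewrite mxE.
  exact: continuous_bigprod.
have xe_eq k (t : R) i : xe t k i 0 = xe t ord0 i 0.
  have [->//|kn0] := eqVneq k ord0.
  wlog t0 : t / 0 <= t.
    by move=> h; have [/h//|/ltW/xe_neg ->] := leP 0 t; exact: h.
  (* The derivatives of factors [k] and [ord0] are [- g Q] times the other of the two, with [Q] the
     product of the remaining factors; so their difference [w] solves [w' = g Q w]. *)
  pose a (s : R) := g s i * \prod_(l | (l != k) && (l != ord0)) xe s l i 0.
  apply/eqP; rewrite -subr_eq0; apply/eqP.
  apply: (linear_ode_zero (fun t => xe t k i 0 - xe t ord0 i 0) a t) => //.
  - by move=> s; apply: cvgB; exact: xe_cont.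
  - move=> s; apply: cvgM; first exact: g_cont.
    exact: continuous_bigprod.
  - move=> s s0; have d := is_deriveB (xe_deriv k i s s0) (xe_deriv ord0 i s s0).
    apply: (is_derive_eq d); rewrite /a (bigD1 ord0) /=; last by rewrite eq_sym.
    rewrite [in X in _ - X](bigD1 k) //=.
    under [in X in _ - X]eq_bigl do rewrite andbC.
    by ring.
  - by rewrite xeE // !x_init subrr.
pose u (t : R) : 'rV[R]_N := \row_i xe t ord0 i 0.
have uE i : (fun t => u t 0 i) = (fun t => xe t ord0 i 0).
  by apply/funext => t; rewrite mxE.
have hadE t : hadL (xe t) = powv n (u t).
  apply/colP => i; rewrite !mxE (eq_bigr (fun=> xe t ord0 i 0)) => [|k _].
    by rewrite prodr_const card_ord.
  exact: xe_eq.
have u_deriv (t : R) i : 0 < t -> is_derive t 1 (fun s => u s 0 i)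
    (- g t i * u t 0 i ^+ n.+1).
  move=> t0; rewrite uE mxE; apply: (is_derive_eq (xe_deriv ord0 i t t0)).
  rewrite mulNr (eq_bigr (fun=> xe t ord0 i 0)) => [|k _]; last exact: xe_eq.
  by rewrite prodr_const cardC1 card_ord.
have uf : power_flow A y n u.
  split=> [i|t i|t i t0].
  - by rewrite uE; exact: xe_cont.
  - wlog t0 : t / 0 <= t.
      move=> h; have [/h//|/ltW/xe_neg ut] := leP 0 t.
      by rewrite mxE ut; have := h 0 (lexx 0); rewrite mxE.
    (* Since [L - 1 >= 1], one factor [u] splits off: [u' = (- g u^(L-2)) u] is linear in [u] with a
       continuous coefficient. *)
    apply: (linear_ode_pos (fun t => u t 0 i) (fun t => - g t i * u t 0 i ^+ n) t) => //.
    + by rewrite uE; exact: xe_cont.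
    + move=> s; apply: cvgM; first by apply: cvgN; exact: g_cont.
      by apply: continuous_pow; rewrite uE; exact: xe_cont.
    + move=> s s0; apply: (is_derive_eq (u_deriv s i s0)).
      by rewrite -mulrA -exprSr.
    + by rewrite mxE xeE // x_init.
  - by rewrite /lsq_grad -hadE; exact: u_deriv.
split=> [|xp xpsol].
  have [c csol uc] := power_flow_cvg A y n u uf.
  exists (powv n c); split => //.
  apply: (@cvg_trans _ ((fun t => powv n (u t)) @ +oo)).
    apply: near_eq_cvg; exists 0; split; first exact: num_real.
    by move=> t t0; rewrite -hadE xeE // ltW.
  apply: cvg_mx => i j; rewrite ord1 !mxE.
  rewrite (_ : (fun t => _) = (fun t => u t 0 i ^+ n.+2)); last first.
    by apply/funext => t; rewrite mxE.
  apply: (@cvg_comp _ _ _ (fun t => u t 0 i) (fun v : R => v ^+ n.+2) _ (nbhs (c 0 i))).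
    exact: uc.
  exact: exprn_continuous.
have [b b0 bxp] := powv_surj n xp xpsol.1; rewrite -{}bxp in xpsol *.
have [_ u0 _] := uf.
have E0 := breg_sum_ge0 n b (u 0) b0 (u0 0).
(* The 2 undoes the half in the loss; the added 1 keeps the constant positive when [u 0 = b]. *)
exists (2 * breg_sum n b (u 0) + 1); split; first by lra.
move=> t t0; rewrite -(xeE t (ltW t0)) hadE.
have := power_flow_rate A y n u b t uf xpsol b0 t0.
have /andP[+ _] := lsq_obj_ge A y n _ _ xpsol (fun i => ltW (u0 t i)).
rewrite -/(lsq_obj A y n b) => h1 h2.
have := le_trans h1 h2; rewrite ler_pdivrMl // mulrA => h3.
apply: (le_trans h3); rewrite ler_pM2r ?invr_gt0 //.
by rewrite lerDl.
Unshelve. all: by end_near. Qed.
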